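(* Let $f_k$ be a swing leg kernel, i.e. a continuous and increasing function giving the step length $l=f_k(\tau)$ of a step that takes a time interval $\tau\in[0,\tau_{max}]$, where $\tau_{max}=f_k^{-1}(l_{max})$ and $l_{max}$ is the maximum normalized step length. Consider the one-dimensional dimensionless linear inverted pendulum model with the foot at $x=0$ at time $0$, in a state whose instantaneous capture point at time $0$ is $x_{ic}(0)=d$. Let $d_{max}=\max_{\tau\in[0,\tau_{max}]} f_k(\tau)/e^{\tau}$. Then the state is 1-step capturable with swing leg kernel $f_k$ if and only if the equation $$d=\frac{f_k(\tau)}{e^{\tau}}$$ has a real solution $\tau\in[0,\tau_{max}]$. This $\tau$ is the related time-margin, and it is generally not unique. Existence of such a $\tau$ is also equivalent to $d\le d_{max}$. The step length $l=f_k(\tau)$ given by such a $\tau$ is a 1-step capture point.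
   Context: Model (dimensionless, one horizontal axis): the center of mass position $x(t)\in\mathbb{R}$ satisfies $\ddot x = x - p$, where $p\in\mathbb{R}$ is the current (point) foot location, constant between steps. The instantaneous capture point is $x_{ic}=x+\dot x$, so $\dot x_{ic}=x_{ic}-p$. A step at time $t$ to location $q$ instantaneously sets $p:=q$, with $x$ and $\dot x$ continuous at time $t$. The robot is captured if, with the foot kept at its current location for all later times, it comes to rest without falling ($\dot x(s)\to 0$ and $x(s)$ converges as $s\to\infty$). The robot stands at $x=0$; at time $0$ a push disturbance acts on it, after which the instantaneous capture point is at $x_{ic}(0)=d$. The state at time $0$ is 1-step capturable with swing leg kernel $f_k$ if there is $\tau\in[0,\tau_{max}]$ such that keeping the foot at $0$ during $[0,\tau]$ and then stepping at time $\tau$ to the location $x=f_k(\tau)$ captures the robot; such a $\tau$ is called a time-margin, and the corresponding location $f_k(\tau)$ a 1-step capture point.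
   Formalization: The equivalence of existence of τ with d ≤ d_max is stated only for d not below all values of f_k(τ)/e^τ on [0,τ_max] (e.g. f_k(0)=0≤d); otherwise it fails, e.g. f_k(τ)=τ, d=−1. *)

(* Defs.v *)
From Stdlib Require Export Reals.
From Coquelicot Require Export Coquelicot.
Open Scope R_scope.

(** [x] is the center of mass position, [v] its velocity and [p s] the foot
    location at time [s].  Between steps, i.e. at times around which [p] is
    constant, [x'' = x - p]; at all times, steps included, [x] and [v] are
    continuous.  Values at negative times play no role. *)
Definition lip_motion (p : R -> R) (x0 v0 : R) (x v : R -> R) : Prop :=
  x 0 = x0 /\ v 0 = v0 /\
  continuous_on (fun s => 0 <= s) x /\
  continuous_on (fun s => 0 <= s) v /\
  (forall t, 0 < t -> locally t (fun s => p s = p t) ->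
     is_derive x t (v t) /\ is_derive v t (x t - p t)).

Definition capture_coordinate (x v : R) : R := x + v.

(** Foot at [0] until a step to [q] at time [tau], kept at [q] ever after. *)
Definition one_step_foot (tau q t : R) : R :=
  if Rlt_dec t tau then 0 else q.

Definition comes_to_rest (x v : R -> R) : Prop :=
  is_lim v p_infty 0 /\ ex_finite_lim x p_infty.

(** Starting at time [0] from position [x0] and velocity [v0] with the foot at
    [0], stepping at time [tau] to [q] captures the robot. *)
Definition step_captures (x0 v0 tau q : R) : Prop :=
  exists x v : R -> R,
    lip_motion (one_step_foot tau q) x0 v0 x v /\ comes_to_rest x v.

(** The last two clauses express [tmax = f^-1(lmax)], the inverse being
    meaningful because [f] is strictly increasing on [[0, tmax]]. *)
Definition swing_leg_kernel (f : R -> R) (lmax tmax : R) : Prop :=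
  continuous_on (fun t => 0 <= t <= tmax) f /\
  (forall s t, 0 <= s -> s < t -> t <= tmax -> f s < f t) /\
  0 <= tmax /\ f tmax = lmax.

Definition time_margin (f : R -> R) (tmax x0 v0 tau : R) : Prop :=
  0 <= tau <= tmax /\ step_captures x0 v0 tau (f tau).

Definition one_step_capturable (f : R -> R) (tmax x0 v0 : R) : Prop :=
  exists tau, time_margin f tmax x0 v0 tau.

Definition one_step_capture_point (f : R -> R) (tmax x0 v0 q : R) : Prop :=
  exists tau, time_margin f tmax x0 v0 tau /\ q = f tau.

Definition is_max_on (g : R -> R) (D : R -> Prop) (m : R) : Prop :=
  (exists t, D t /\ g t = m) /\ (forall t, D t -> g t <= m).

(* Main.v *)
(** The capture point [c = x + v] satisfies [c' = c - p], so it equals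
    [d * exp t] until the step, and afterwards [(c t - q) * exp (- t)] is
    constant.  If the robot comes to rest, [c] has a finite limit, so this
    constant is zero, i.e. [d * exp tau = q].  Conversely, if
    [d * exp tau = q] then the motion can be written down explicitly and
    converges to [q].  The criterion [d <= dmax] is the intermediate value
    theorem for [f tau / exp tau]. *)

Require Import Defs.
From Stdlib Require Import Lra.

(** * Continuity, maxima and intermediate values on an interval *)

Lemma continuous_Rmax_l (a t : R) : continuous (fun s => Rmax a s) t.
Proof.
  apply (continuous_ext (fun s => (a + s + Rabs (a - s)) / 2)).
  { intros s. unfold Rmax, Rabs; destruct (Rle_dec a s), (Rcase_abs (a - s)); lra. }
  apply (continuous_scal_l (fun s => a + s + Rabs (a - s)) (/ 2)).
  apply (continuous_plus (fun s => a + s)).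
  - apply (continuous_plus (fun _ => a)); [apply continuous_const | apply continuous_id].
  - apply continuous_comp; [|apply continuous_Rabs].
    apply (continuous_minus (fun _ => a)); [apply continuous_const | apply continuous_id].
Qed.

Lemma continuous_Rmin_r (b t : R) : continuous (fun s => Rmin s b) t.
Proof.
  apply (continuous_ext (fun s => - Rmax (- b) (- s))).
  { intros s. unfold Rmin, Rmax; destruct (Rle_dec (- b) (- s)), (Rle_dec s b); lra. }
  apply (continuous_opp (fun s => Rmax (- b) (- s))).
  apply (continuous_comp Ropp (Rmax (- b))); [|apply continuous_Rmax_l].
  apply (continuous_opp (fun s : R => s)), continuous_id.
Qed.

(** [continuous_on D] only gives limits within [D]. Since [r] never leaves [D], composing with it
    yields ordinary two-sided continuity at every real. *)
Lemma continuous_retract (D : R -> Prop) (g r : R -> R) :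
  continuous_on D g -> (forall s, D (r s)) -> (forall s, continuous r s) ->
  forall t, continuous (fun s => g (r s)) t.
Proof.
  intros Hg HD Hr t.
  apply (filterlim_comp _ _ _ r g _ (within D (locally (r t)))).
  - intros P HP. generalize (Hr t _ HP). unfold filtermap.
    apply filter_imp. intros s Hs. now apply Hs.
  - apply Hg, HD.
Qed.

Lemma derive_zero_const (g : R -> R) (a b : R) :
  a <= b -> (forall t, continuous g t) ->
  (forall t, a < t < b -> is_derive g t 0) -> g b = g a.
Proof.
  intros Hab Hc Hder.
  destruct (MVT_gen g a b (fun _ => 0)) as [c [_ Hmvt]].
  - rewrite Rmin_left, Rmax_right by lra. exact Hder.
  - intros t _. apply continuity_pt_filterlim, Hc.
  - lra.
Qed.

(** Clamping the argument to the interval extends [g] continuously to the whole line without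
    changing it on the interval, so that theorems about two-sided continuity apply. *)
Lemma continuous_on_interval_retract (g : R -> R) (a b : R) :
  a <= b -> continuous_on (fun t => a <= t <= b) g ->
  exists r : R -> R,
    (forall t, a <= r t <= b) /\ (forall t, a <= t <= b -> r t = t) /\
    (forall t, continuous (fun s => g (r s)) t).
Proof.
  intros Hab Hg. pose (r t := Rmax a (Rmin t b)).
  assert (Hr : forall t, a <= r t <= b).
  { intros t; unfold r, Rmax, Rmin.
    destruct (Rle_dec t b); [destruct (Rle_dec a t)|destruct (Rle_dec a b)]; lra. }
  exists r. split; [exact Hr|split].
  - intros t Ht; unfold r. rewrite Rmin_left by lra. apply Rmax_right; lra.
  - apply (continuous_retract (fun t => a <= t <= b)); [exact Hg|exact Hr|].
    intros t. apply (continuous_comp (fun s => Rmin s b));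
      [apply continuous_Rmin_r | apply continuous_Rmax_l].
Qed.

Lemma continuous_on_max (g : R -> R) (a b : R) :
  a <= b -> continuous_on (fun t => a <= t <= b) g ->
  exists m, is_max_on g (fun t => a <= t <= b) m.
Proof.
  intros Hab Hg.
  destruct (continuous_on_interval_retract g a b Hab Hg) as (r & Hr & Hrid & Hrc).
  destruct (continuity_ab_maj (fun t => g (r t)) a b Hab) as [t [Hmax Ht]].
  { intros t _. apply continuity_pt_filterlim, Hrc. }
  exists (g t). split; [now exists t|].
  intros s Hs. generalize (Hmax s Hs). simpl. now rewrite !Hrid.
Qed.

Lemma continuous_on_IVT (g : R -> R) (a b s t y : R) :
  continuous_on (fun t => a <= t <= b) g ->
  a <= s <= b -> a <= t <= b -> g s <= y <= g t ->
  exists u, a <= u <= b /\ g u = y.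
Proof.
  intros Hg Hs Ht Hy. assert (Hab : a <= b) by lra.
  destruct (continuous_on_interval_retract g a b Hab Hg) as (r & Hr & Hrid & Hrc).
  destruct (IVT_gen (fun t => g (r t)) s t y) as [u [_ Hu]].
  - intros t'. apply continuity_pt_filterlim, Hrc.
  - rewrite !Hrid by assumption. rewrite Rmin_left, Rmax_right; lra.
  - now exists (r u).
Qed.

Lemma continuous_on_div_exp (D : R -> Prop) (f : R -> R) :
  continuous_on D f -> continuous_on D (fun t => f t / exp t).
Proof.
  intros Hf t Ht.
  apply (filterlim_comp_2 (G := locally (f t)) (H := locally (/ exp t)) f
           (fun t => / exp t) Rmult).
  - now apply Hf.
  - apply (filterlim_filter_le_1 (F := locally t));
      [apply filter_le_within|].
    apply (ex_derive_continuous (fun t => / exp t)).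
    auto_derive. apply Rgt_not_eq, exp_pos.
  - apply (filterlim_mult (K := R_AbsRing)).
Qed.

(** * Dynamics of the capture point and of the captured motion *)

Lemma is_lim_exp_opp : is_lim (fun t => exp (- t)) p_infty 0.
Proof.
  apply (is_lim_comp exp Ropp p_infty 0 m_infty).
  - exact is_lim_exp_m.
  - apply (is_lim_opp (fun t => t) p_infty p_infty), is_lim_id.
  - now exists 0.
Qed.

Lemma one_step_foot_before (tau q t : R) : t < tau -> one_step_foot tau q t = 0.
Proof. intros Ht; unfold one_step_foot; destruct (Rlt_dec t tau); lra. Qed.

Lemma one_step_foot_after (tau q t : R) : tau <= t -> one_step_foot tau q t = q.
Proof. intros Ht; unfold one_step_foot; destruct (Rlt_dec t tau); lra. Qed.

(** With the foot at [q], the difference [x + v - q] is its own derivative, so the factor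
    [exp (- t)] makes it constant. Asking for the foot position only on the open interval lets [b]
    be the instant of the step; continuity carries the identity to the endpoints. *)
Lemma capture_coordinate_const_foot (p x v : R -> R) (x0 v0 a b q : R) :
  lip_motion p x0 v0 x v -> 0 <= a <= b ->
  (forall t, a < t < b -> p t = q) ->
  (x b + v b - q) * exp (- b) = (x a + v a - q) * exp (- a).
Proof.
  intros (_ & _ & Hx & Hv & Hode) [Ha Hab] Hp.
  (* The motion is continuous only on nonnegative times; [Rmax 0] freezes it before time 0, so that
     [h] is continuous everywhere, even when [a = 0]. *)
  pose (h t := (x (Rmax 0 t) + v (Rmax 0 t) - q) * exp (- t)).
  assert (Hh : h b = h a).
  { apply derive_zero_const; [assumption| |].
    - assert (Hret : forall g : R -> R, continuous_on (fun s => 0 <= s) g ->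
                forall t, continuous (fun s => g (Rmax 0 s)) t).
      { intros g Hg. apply (continuous_retract _ g (Rmax 0) Hg).
        - intros s; apply Rmax_l.
        - intros s; apply continuous_Rmax_l. }
      intros t. apply (continuous_mult (fun t => x (Rmax 0 t) + v (Rmax 0 t) - q)).
      + apply (continuous_minus (fun t => x (Rmax 0 t) + v (Rmax 0 t)));
          [|apply continuous_const].
        apply (continuous_plus (fun t => x (Rmax 0 t))); now apply Hret.
      + apply (ex_derive_continuous (fun t => exp (- t))). now auto_derive.
    - intros t Ht.
      apply (is_derive_ext_loc (fun t => (x t + v t - q) * exp (- t))).
      { assert (H0 : 0 < t) by lra.
        generalize (locally_interval (fun s => 0 < s) t 0 p_infty H0 I (fun s h _ => h)).
        apply filter_imp; intros s Hs. unfold h. now rewrite Rmax_right by lra. }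
      destruct (Hode t ltac:(lra)) as [Dx Dv].
      { generalize (locally_interval (fun s => a < s < b) t a b
                      (proj1 Ht) (proj2 Ht) (fun s h1 h2 => conj h1 h2)).
        apply filter_imp; intros s Hs. now rewrite !Hp. }
      rewrite (Hp t Ht) in Dv.
      auto_derive.
      { split; [now exists (v t)|split; [now exists (x t - q)|exact I]]. }
      replace (Derive _ t) with (v t) by (symmetry; apply is_derive_unique, Dx).
      replace (Derive _ t) with (x t - q) by (symmetry; apply is_derive_unique, Dv).
      ring. }
  unfold h in Hh. now rewrite !Rmax_right in Hh by lra.
Qed.

Lemma step_captures_necessary (x0 v0 tau q : R) :
  0 <= tau -> step_captures x0 v0 tau q -> (x0 + v0) * exp tau = q.
Proof.
  intros Htau (x & v & Hm & Hv & L & Hx).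
  assert (Hbefore : (x tau + v tau) * exp (- tau) = x0 + v0).
  { destruct (Hm) as (Ex & Ev & _).
    generalize (capture_coordinate_const_foot _ _ _ _ _ 0 tau 0 Hm (conj (Rle_refl 0) Htau)
                  (fun t Ht => one_step_foot_before tau q t (proj2 Ht))).
    rewrite Ropp_0, exp_0, Ex, Ev. lra. }
  pose (K := (x tau + v tau - q) * exp (- tau)).
  assert (Hafter : forall t, tau < t -> (x t + v t - q) * exp (- t) = K).
  { intros t Ht.
    refine (capture_coordinate_const_foot _ _ _ _ _ tau t q Hm _ _); [lra|].
    intros s Hs. apply one_step_foot_after; lra. }
  assert (HK : K = 0).
  { assert (E : Finite K = Finite ((L + 0 - q) * 0)).
    { rewrite <- (is_lim_unique (fun t => (x t + v t - q) * exp (- t)) p_infty K).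
      - apply is_lim_unique.
        apply (is_lim_mult _ _ p_infty (L + 0 - q) 0); [|exact is_lim_exp_opp|exact I].
        apply (is_lim_minus' _ _ p_infty (L + 0) q); [|apply is_lim_const].
        now apply (is_lim_plus' x v p_infty L 0).
      - apply (is_lim_ext_loc (fun _ => K)); [|apply is_lim_const].
        exists tau. intros t Ht. symmetry. now apply Hafter. }
    injection E as E. lra. }
  unfold K in HK.
  assert (He : exp (- tau) * exp tau = 1).
  { rewrite <- exp_plus, Rplus_opp_l. apply exp_0. }
  assert (Hq : x tau + v tau = q).
  { apply Rmult_integral in HK as [HK|HK]; [lra|].
    generalize (exp_pos (- tau)); lra. }
  rewrite <- Hbefore, Hq, Rmult_assoc, He. ring.
Qed.

(** With [m = min t tau], the solution of [x' = - x + c] for the capture point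
    [c t = d * exp m], which stays at [q = d * exp tau] after the step. *)
Lemma step_captures_sufficient (x0 v0 tau q : R) :
  0 <= tau -> (x0 + v0) * exp tau = q -> step_captures x0 v0 tau q.
Proof.
  intros Htau Hq.
  set (d := x0 + v0) in *.
  (* Amplitude of the decaying mode: before the step, [x] is [d / 2 * exp t + b * exp (- t)]. *)
  set (b := (x0 - v0) / 2).
  (* The exponent [2 * Rmin t tau - t] equals [t] before the step and [2 * tau - t] after it, so the
     growing mode turns into a decaying one and [v] stays continuous at [tau]. *)
  pose (v t := d / 2 * exp (2 * Rmin t tau - t) - b * exp (- t)).
  pose (x t := d * exp (Rmin t tau) - v t).
  pose (w := d / 2 * exp (2 * tau) - b).
  assert (Hv_early : forall t, t <= tau -> v t = d / 2 * exp t - b * exp (- t)).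
  { intros t Ht. unfold v. rewrite Rmin_left by lra.
    now replace (2 * t - t) with t by ring. }
  assert (Hx_early : forall t, t <= tau -> x t = d / 2 * exp t + b * exp (- t)).
  { intros t Ht. unfold x. rewrite Hv_early, Rmin_left by lra. field. }
  assert (Hv_late : forall t, tau <= t -> v t = w * exp (- t)).
  { intros t Ht. unfold v, w. rewrite Rmin_right by lra.
    unfold Rminus. rewrite exp_plus. ring. }
  assert (Hx_late : forall t, tau <= t -> x t = q - w * exp (- t)).
  { intros t Ht. unfold x. now rewrite Hv_late, Rmin_right, Hq by lra. }
  assert (Hm : forall t, continuous (fun s => Rmin s tau) t)
    by (intros t; apply continuous_Rmin_r).
  assert (Hexp : forall (g : R -> R) (t : R), continuous g t -> continuous (fun s => exp (g s)) t).
  { intros g t Hg. apply (continuous_comp g); [exact Hg|apply continuous_exp]. }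
  assert (Hvc : forall t, continuous v t).
  { intros t. apply (continuous_minus (fun t => d / 2 * exp (2 * Rmin t tau - t))).
    - apply (continuous_scal_r (d / 2) (fun t => exp (2 * Rmin t tau - t))).
      apply Hexp. apply (continuous_minus (fun t => 2 * Rmin t tau)); [|apply continuous_id].
      now apply (continuous_scal_r 2 (fun t => Rmin t tau)).
    - apply (ex_derive_continuous (fun t => b * exp (- t))). now auto_derive. }
  assert (Hxc : forall t, continuous x t).
  { intros t. apply (continuous_minus (fun t => d * exp (Rmin t tau))); [|apply Hvc].
    apply (continuous_scal_r d (fun t => exp (Rmin t tau))). now apply Hexp. }
  exists x, v. split; [split; [|split; [|split; [|split]]]|split].
  - rewrite Hx_early, Ropp_0, exp_0 by lra. unfold d, b. field.
  - rewrite Hv_early, Ropp_0, exp_0 by lra. unfold d, b. field.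
  - apply continuous_on_forall. intros t _; apply Hxc.
  - apply continuous_on_forall. intros t _; apply Hvc.
  - intros t Ht Hloc.
    destruct (Rtotal_order t tau) as [Hlt|[Heq|Hgt]].
    + rewrite one_step_foot_before by assumption.
      assert (Hs : locally t (fun s => s < tau))
        by exact (locally_interval _ t m_infty tau I Hlt (fun s _ h => h)).
      split.
      * apply (is_derive_ext_loc (fun t => d / 2 * exp t + b * exp (- t))).
        { revert Hs; apply filter_imp; intros s Hs. symmetry. now apply Hx_early, Rlt_le. }
        rewrite Hv_early by lra. auto_derive; [trivial|field].
      * apply (is_derive_ext_loc (fun t => d / 2 * exp t - b * exp (- t))).
        { revert Hs; apply filter_imp; intros s Hs. symmetry. now apply Hv_early, Rlt_le. }
        rewrite Hx_early by lra. auto_derive; [trivial|field].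
    + (* The foot is constant around [tau] only if [q = 0], i.e. no step is made. *)
      assert (Hq0 : q = 0).
      { destruct Hloc as [e He].
        (* A point just left of [tau], where the foot is still at 0, lies in the neighbourhood on
           which the foot is assumed constant. *)
        assert (Hball : ball t e (t - e / 2)).
        { change (Rabs ((t - e / 2) - t) < e). destruct e as [e He0]; simpl.
          rewrite Rabs_left; lra. }
        apply He in Hball. destruct e as [e He0]; simpl in Hball.
        rewrite one_step_foot_before, one_step_foot_after in Hball by lra. lra. }
      assert (Hd0 : d = 0).
      { rewrite Hq0 in Hq. apply Rmult_integral in Hq as [Hq|Hq]; [exact Hq|].
        generalize (exp_pos tau); lra. }
      rewrite one_step_foot_after by lra.
      (* With [d = 0] only the decaying mode remains, and one formula holds on both sides of [tau],
         which makes the motion differentiable there. *)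
      assert (Hv0 : forall t, v t = - b * exp (- t))
        by (intros s; unfold v; rewrite Hd0; field).
      assert (Hx0 : forall t, x t = b * exp (- t))
        by (intros s; unfold x; rewrite Hv0, Hd0; ring).
      split.
      * apply (is_derive_ext (fun t => b * exp (- t)));
          [intros s; symmetry; apply Hx0|].
        rewrite Hv0. auto_derive; [trivial|ring].
      * apply (is_derive_ext (fun t => - b * exp (- t)));
          [intros s; symmetry; apply Hv0|].
        rewrite Hx0, Hq0. auto_derive; [trivial|ring].
    + rewrite one_step_foot_after by lra.
      assert (Hs : locally t (fun s => tau < s))
        by exact (locally_interval _ t tau p_infty Hgt I (fun s h _ => h)).
      split.
      * apply (is_derive_ext_loc (fun t => q - w * exp (- t))).
        { revert Hs; apply filter_imp; intros s Hs. symmetry. now apply Hx_late, Rlt_le. }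
        rewrite Hv_late by lra. auto_derive; [trivial|ring].
      * apply (is_derive_ext_loc (fun t => w * exp (- t))).
        { revert Hs; apply filter_imp; intros s Hs. symmetry. now apply Hv_late, Rlt_le. }
        rewrite Hx_late by lra. auto_derive; [trivial|ring].
  - apply (is_lim_ext_loc (fun t => w * exp (- t))).
    { exists tau. intros t Ht. symmetry. now apply Hv_late, Rlt_le. }
    replace (Finite 0) with (Rbar_mult w 0) by (simpl; f_equal; ring).
    apply is_lim_scal_l, is_lim_exp_opp.
  - exists q. apply (is_lim_ext_loc (fun t => q - w * exp (- t))).
    { exists tau. intros t Ht. symmetry. now apply Hx_late, Rlt_le. }
    replace (Finite q) with (Finite (q - w * 0)) by (f_equal; ring).
    apply (is_lim_minus' _ _ p_infty q (w * 0)); [apply is_lim_const|].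
    apply (is_lim_scal_l (fun t => exp (- t)) w p_infty 0), is_lim_exp_opp.
Qed.

(** * Capture criterion and time-margins *)

Lemma step_captures_iff (x0 v0 tau q : R) :
  0 <= tau -> step_captures x0 v0 tau q <-> x0 + v0 = q / exp tau.
Proof.
  intros Htau. assert (He := exp_pos tau). split; intros H.
  - rewrite <- (step_captures_necessary x0 v0 tau q Htau H). field. lra.
  - apply step_captures_sufficient; [exact Htau|]. rewrite H. field. lra.
Qed.

Lemma time_margin_iff (f : R -> R) (tmax x0 v0 tau : R) :
  time_margin f tmax x0 v0 tau <->
  0 <= tau <= tmax /\ x0 + v0 = f tau / exp tau.
Proof.
  split; intros [Htau H]; (split; [exact Htau|]);
    apply (step_captures_iff x0 v0 tau (f tau)); tauto.
Qed.

(** For [f tau = tau], both [ln 2] and [2 * ln 2] give [ln 2 / 2]. *)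
Lemma time_margin_not_unique :
  exists (g : R -> R) (lg tg y0 w0 tau1 tau2 : R),
    swing_leg_kernel g lg tg /\ g 0 = 0 /\ tau1 <> tau2 /\
    time_margin g tg y0 w0 tau1 /\ time_margin g tg y0 w0 tau2.
Proof.
  assert (Hln : 0 < ln 2) by (rewrite <- ln_1; apply ln_increasing; lra).
  exists (fun t => t), (2 * ln 2), (2 * ln 2), (ln 2 / 2), 0, (ln 2), (2 * ln 2).
  split; [|split; [|split; [|split]]].
  - repeat split; [|intros; assumption|lra].
    apply continuous_on_forall. intros t _; apply continuous_id.
  - reflexivity.
  - lra.
  - apply time_margin_iff. split; [lra|]. rewrite exp_ln by lra. lra.
  - apply time_margin_iff. split; [lra|].
    replace (exp (2 * ln 2)) with 4; [lra|].
    replace (2 * ln 2) with (ln 2 + ln 2) by ring.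
    rewrite exp_plus, exp_ln by lra. lra.
Qed.

Theorem theorem3 (f : R -> R) (lmax tmax x0 v0 d : R)
  (Hf : swing_leg_kernel f lmax tmax)
  (Hd : capture_coordinate x0 v0 = d) :
  (* 1-step capturability *)
  (one_step_capturable f tmax x0 v0 <->
     exists tau, 0 <= tau <= tmax /\ d = f tau / exp tau) /\
  (* the solutions are the time-margins *)
  (forall tau, time_margin f tmax x0 v0 tau <->
     0 <= tau <= tmax /\ d = f tau / exp tau) /\
  (* the time-margin is in general not unique *)
  (exists (g : R -> R) (lg tg y0 w0 tau1 tau2 : R),
     swing_leg_kernel g lg tg /\ g 0 = 0 /\ tau1 <> tau2 /\
     time_margin g tg y0 w0 tau1 /\ time_margin g tg y0 w0 tau2) /\
  (* d_max exists, and a solution exists iff d <= d_max, for d not below all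
     the values of f(tau)/e^tau (as is the case when f 0 = 0 <= d) *)
  (exists dmax,
     is_max_on (fun tau => f tau / exp tau) (fun tau => 0 <= tau <= tmax) dmax /\
     ((exists t0, 0 <= t0 <= tmax /\ f t0 / exp t0 <= d) ->
      ((exists tau, 0 <= tau <= tmax /\ d = f tau / exp tau) <-> d <= dmax))) /\
  (* the corresponding step lengths are 1-step capture points *)
  (forall tau, 0 <= tau <= tmax -> d = f tau / exp tau ->
     one_step_capture_point f tmax x0 v0 (f tau)).
Proof.
  unfold capture_coordinate in Hd. subst d.
  assert (Hiff := time_margin_iff f tmax x0 v0).
  split; [|split; [|split; [|split]]].
  - split; intros [tau H]; exists tau; now apply Hiff.
  - exact Hiff.
  - exact time_margin_not_unique.
  - destruct Hf as (Hc & _ & Hmax & _).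
    apply continuous_on_div_exp in Hc.
    destruct (continuous_on_max _ 0 tmax Hmax Hc) as [dmax Hdmax].
    exists dmax. split; [exact Hdmax|].
    destruct Hdmax as [[t1 [Ht1 E1]] Hle].
    intros [t0 [Ht0 H0]]. split.
    + intros [tau [Htau ->]]. exact (Hle tau Htau).
    + intros Hd.
      (* The value [x0 + v0] is bracketed by the values at [t0] and at the maximizer [t1]; these two
         times may come in either order. *)
      destruct (continuous_on_IVT _ 0 tmax t0 t1 (x0 + v0) Hc Ht0 Ht1) as [u [Hu E]].
      * split; [exact H0|]. now rewrite E1.
      * now exists u.
  - intros tau Htau E. exists tau. split; [|reflexivity]. now apply Hiff.
Qed.
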